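(* Let $R$ be a ring with $1\neq 0$ (not necessarily commutative), let $n\geq 2$, and let $a_1,\dots,a_n$ be elements of the center of $R$ with $Ra_1+\cdots+Ra_n=R$. Let $S=\{(x_1,\dots,x_n)\in R^n : a_1x_1+\cdots+a_nx_n=0\}$, and let $M\subseteq\{1,\dots,n\}$ be a subset with $\sum_{i\in M}Ra_i=R$. Then $a_iS\subseteq S_i$ for all $1\leq i\leq n$; consequently $S=S_M$ and $S$ is spanned over $R$ by $B_M$.
   Context: $R^n$ is regarded as a left $R$-module, and $S$ is a submodule of it since the $a_i$ are central. For $1\leq i\neq j\leq n$, $v(i,j)\in S$ is the vector whose $i$th entry is $-a_j$, whose $j$th entry is $a_i$, and whose other entries are $0$ (so $v(j,i)=-v(i,j)$). $S_i$ is the $R$-span of all $v(i,j)$ with $j\neq i$. For $M\subseteq\{1,\dots,n\}$, $S_M=\sum_{i\in M}S_i$ and $B_M=\{v(i,j) : 1\leq i<j\leq n,\ \{i,j\}\cap M\neq\emptyset\}$. *)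

(* Defs.v *)
From HB Require Import structures.
From mathcomp Require Import all_boot all_order all_algebra.
From mathcomp Require Import boolp classical_sets.

Set Implicit Arguments.
Unset Strict Implicit.
Unset Printing Implicit Defensive.

Import GRing.Theory.
Local Open Scope ring_scope.
Local Open Scope classical_set_scope.

Definition in_center (R : nzRingType) (z : R) : Prop :=
  forall x : R, GRing.comm z x.

Definition left_multiples (R : nzRingType) (b : R) : set R :=
  [set y | exists r : R, y = r * b].

Definition set_sum (V : nmodType) (I : finType) (M : {set I})
    (U : I -> set V) : set V :=
  [set x | exists2 y : I -> V,
     (forall i, i \in M -> U i (y i)) & x = \sum_(i in M) y i].

(* The terms need not be distinct and k may be 0, so this is the smallest
   submodule containing X. *)
Definition lspan (R : nzRingType) (V : lmodType R) (X : set V) : set V :=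
  [set x | exists k : nat, exists c : 'I_k -> R, exists u : 'I_k -> V,
     (forall i, X (u i)) /\ x = \sum_(i < k) c i *: u i].

(* R^n is 'rV[R]_n: its scaling *: multiplies every entry on the left, and the
   i-th coordinate of x is x 0 i. *)
Definition syzygies (R : nzRingType) (n : nat) (a : 'I_n -> R)
    : set 'rV[R]_n :=
  [set x | \sum_(i < n) a i * x 0 i = 0].

(* Meaningful for i != j only; every use below carries that condition. *)
Definition koszul (R : nzRingType) (n : nat) (a : 'I_n -> R) (i j : 'I_n)
    : 'rV[R]_n :=
  \row_k (if k == i then - a j else if k == j then a i else 0).

Definition koszul_at (R : nzRingType) (n : nat) (a : 'I_n -> R) (i : 'I_n)
    : set 'rV[R]_n :=
  lspan [set w | exists2 j : 'I_n, j != i & w = koszul a i j].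

Definition koszul_sum (R : nzRingType) (n : nat) (a : 'I_n -> R)
    (M : {set 'I_n}) : set 'rV[R]_n :=
  set_sum M (koszul_at a).

Definition koszul_gens (R : nzRingType) (n : nat) (a : 'I_n -> R)
    (M : {set 'I_n}) : set 'rV[R]_n :=
  [set w | exists i j : 'I_n,
     [/\ (i < j)%N, ([set i; j] :&: M)%SET != finset.set0 & w = koszul a i j]].

(* Main.v *)
(* A syzygy x satisfies a_i x = sum over j <> i of x_j v(i,j): the i-th entries
   agree because a_i x_i = - sum over j <> i of a_j x_j.  Writing
   1 = sum over i in M of r_i a_i then gives x = sum of r_i (a_i x), so S is
   contained in S_M, which is contained in the span of B_M, which is contained
   in S. *)
Require Import Defs.
From HB Require Import structures.
From mathcomp Require Import all_boot all_order all_algebra.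
From mathcomp Require Import boolp classical_sets.

Set Implicit Arguments.
Unset Strict Implicit.
Unset Printing Implicit Defensive.

Import GRing.Theory.
Local Open Scope ring_scope.
Local Open Scope classical_set_scope.

(** One closure condition covers both operations: [c = 1] gives sums and [y = 0] gives left
    multiples. *)
Definition submodule_set (R : nzRingType) (V : lmodType R) (U : set V) : Prop :=
  U 0 /\ forall (c : R) (x y : V), U x -> U y -> U (c *: x + y).

Lemma submodule_scale (R : nzRingType) (V : lmodType R) (U : set V)
    (c : R) (x : V) : submodule_set U -> U x -> U (c *: x).
Proof. by case=> U0 UD Ux; rewrite -[_ *: _]addr0; apply: UD. Qed.

Lemma submodule_sum (R : nzRingType) (V : lmodType R) (U : set V)
    (I : finType) (P : pred I) (F : I -> V) :
  submodule_set U -> (forall i, P i -> U (F i)) -> U (\sum_(i | P i) F i).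
Proof.
move=> [U0 UD] UF; elim/big_ind: _ => // x y Ux Uy.
by rewrite -[x]scale1r; apply: UD.
Qed.

Lemma lspan_submodule (R : nzRingType) (V : lmodType R) (X : set V) :
  submodule_set (lspan X).
Proof.
split=> [|c _ _ [k [d [u [Xu ->]]]] [l [e [w [Xw ->]]]]].
  exists 0%N, (fun=> 0), (fun=> 0); split; first by case.
  by rewrite big_ord0.
(* The two linear combinations are concatenated; [split] tells which of them an index below [k + l]
   comes from. *)
exists (k + l)%N,
  (fun i => match split i with inl j => c * d j | inr j => e j end),
  (fun i => match split i with inl j => u j | inr j => w j end).
split=> [i|]; first by case: (split i).
rewrite big_split_ord scaler_sumr; congr (_ + _); apply: eq_bigr => i _.
  by rewrite (unsplitK (inl _ i)) scalerA.
by rewrite (unsplitK (inr _ i)).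
Qed.

Lemma lspan_gen (R : nzRingType) (V : lmodType R) (X : set V) : X `<=` lspan X.
Proof.
move=> x Xx; exists 1%N, (fun=> 1), (fun=> x); split=> //.
by rewrite big_ord1 scale1r.
Qed.

Lemma lspan_min (R : nzRingType) (V : lmodType R) (X U : set V) :
  submodule_set U -> X `<=` U -> lspan X `<=` U.
Proof.
move=> sU XU _ [k [c [u [Xu ->]]]]; apply: submodule_sum => // i _.
by apply: submodule_scale => //; apply: XU.
Qed.

(** Distinct indices matter: when they coincide the first branch of [koszul] wins, the only entry
    left is [- a i], and antisymmetry can fail. *)
Lemma koszulC (R : nzRingType) (n : nat) (a : 'I_n -> R) (i j : 'I_n) :
  i != j -> koszul a j i = - koszul a i j.
Proof.
move=> neq_ij; apply/rowP=> k; rewrite !mxE.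
case: (eqVneq k j) => [->|_]; first by rewrite eq_sym (negPf neq_ij).
by case: eqP => _; rewrite ?opprK ?oppr0.
Qed.

Lemma syzygies_submodule (R : nzRingType) (n : nat) (a : 'I_n -> R) :
  (forall i, in_center (a i)) -> submodule_set (syzygies a).
Proof.
move=> aC; split=> [|c x y]; rewrite /syzygies /=.
  by rewrite big1 // => i _; rewrite mxE mulr0.
move=> Sx Sy; transitivity (c * \sum_i a i * x 0 i + \sum_i a i * y 0 i).
  rewrite mulr_sumr -big_split; apply: eq_bigr => i _ /=.
  (* Centrality moves the scalar out on the left: [a i * c = c * a i]. *)
  by rewrite !mxE mulrDr !mulrA (aC i c).
by rewrite Sx Sy mulr0 addr0.
Qed.

(** Only the entries [i] and [j] contribute, and [- (a i * a j) + a j * a i] vanishes because [a i]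
    is central. *)
Lemma koszul_syzygy (R : nzRingType) (n : nat) (a : 'I_n -> R) (i j : 'I_n) :
  (forall i, in_center (a i)) -> i != j -> syzygies a (koszul a i j).
Proof.
move=> aC neq_ij; rewrite /syzygies /= (bigD1 i) //= (bigD1 j) 1?eq_sym //=.
rewrite big1 => [|k /andP[/negPf ki /negPf kj]]; last by rewrite mxE ki kj mulr0.
by rewrite !mxE !eqxx eq_sym (negPf neq_ij) addr0 mulrN (aC i (a j)) addNr.
Qed.

Lemma scale_syzygy (R : nzRingType) (n : nat) (a : 'I_n -> R) (i : 'I_n)
    (x : 'rV[R]_n) :
  (forall i, in_center (a i)) -> syzygies a x ->
  a i *: x = \sum_(j | j != i) x 0 j *: koszul a i j.
Proof.
move=> aC; rewrite /syzygies /= (bigD1 i) //= => /eqP; rewrite addr_eq0 => /eqP Sx.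
apply/rowP=> k; rewrite mxE summxE.
have [->|neq_ki] := eqVneq k i.
  (* At entry [i] the syzygy relation itself gives the sum, term by term. *)
  rewrite Sx -sumrN; apply: eq_bigr => j _.
  by rewrite !mxE eqxx mulrN (aC j (x 0 j)).
(* At any other entry [k] only the term [j = k] survives; it equals [x 0 k * a i]. *)
rewrite (bigD1 k) //= !mxE (negPf neq_ki) eqxx big1 => [|j /andP[_ neq_jk]].
  by rewrite addr0 (aC i (x 0 k)).
by rewrite !mxE (negPf neq_ki) eq_sym (negPf neq_jk) mulr0.
Qed.

Lemma scale_syzygies_sub (R : nzRingType) (n : nat) (a : 'I_n -> R) (i : 'I_n) :
  (forall i, in_center (a i)) ->
  [set a i *: x | x in syzygies a] `<=` koszul_at a i.
Proof.
move=> aC _ [x Sx <-]; rewrite scale_syzygy //.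
apply: submodule_sum => [|j neq_ji]; first exact: lspan_submodule.
apply: submodule_scale; first exact: lspan_submodule.
by apply: lspan_gen; exists j.
Qed.

Lemma syzygies_sub_koszul_sum (R : nzRingType) (n : nat) (a : 'I_n -> R)
    (M : {set 'I_n}) :
  (forall i, in_center (a i)) ->
  set_sum M (fun i => left_multiples (a i)) 1 ->
  syzygies a `<=` koszul_sum a M.
Proof.
(* Here [r i] is a whole summand [b * a i] of 1, not its coefficient, so [r i *: x] is [b] times
   [a i *: x]. *)
move=> aC [r ra def1] x Sx; exists (fun i => r i *: x) => [i /ra[b ->]|].
  rewrite -scalerA; apply: submodule_scale; first exact: lspan_submodule.
  by apply: scale_syzygies_sub => //; exists x.
by rewrite -scaler_suml -def1 scale1r.
Qed.

Lemma koszul_sum_sub_lspan (R : nzRingType) (n : nat) (a : 'I_n -> R)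
    (M : {set 'I_n}) :
  koszul_sum a M `<=` lspan (koszul_gens a M).
Proof.
have sB := lspan_submodule (koszul_gens a M).
move=> _ [y Sy ->]; apply: submodule_sum => // i iM.
apply: lspan_min (Sy i iM) => // _ [j neq_ji ->].
(* The generators list each pair in increasing order only; for [j < i] the vector is the opposite of
   a listed one. In both cases [i] witnesses that the pair meets [M]. *)
case: (ltngtP i j) => [lt_ij|lt_ji|/val_inj eq_ij]; last by rewrite eq_ij eqxx in neq_ji.
  apply: lspan_gen; exists i, j; split=> //.
  by apply/set0Pn; exists i; rewrite !inE eqxx.
rewrite koszulC // -scaleN1r; apply: submodule_scale => //.
apply: lspan_gen; exists j, i; split=> //.
by apply/set0Pn; exists i; rewrite !inE eqxx orbT.
Qed.

Lemma lspan_koszul_gens_sub (R : nzRingType) (n : nat) (a : 'I_n -> R)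
    (M : {set 'I_n}) :
  (forall i, in_center (a i)) -> lspan (koszul_gens a M) `<=` syzygies a.
Proof.
move=> aC; apply: lspan_min => [|_ [i [j [lt_ij _ ->]]]].
  exact: syzygies_submodule.
by apply: koszul_syzygy => //; rewrite -val_eqE /= ltn_eqF.
Qed.

Theorem lemma2p1 (R : nzRingType) (n : nat) (a : 'I_n -> R) (M : {set 'I_n})
    (hn : (2 <= n)%N)
    (hcenter : forall i : 'I_n, in_center (a i))
    (hunimodular :
       set_sum [set: 'I_n]%SET (fun i => left_multiples (a i)) = [set: R])
    (hM : set_sum M (fun i => left_multiples (a i)) = [set: R]) :
  [/\ forall i : 'I_n, [set a i *: x | x in syzygies a] `<=` koszul_at a i,
      syzygies a = koszul_sum a M
    & syzygies a = lspan (koszul_gens a M)].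
Proof.
have S_sub : syzygies a `<=` koszul_sum a M.
  by apply: syzygies_sub_koszul_sum => //; rewrite hM.
have SM_sub := @koszul_sum_sub_lspan R n a M.
have B_sub := lspan_koszul_gens_sub (M := M) hcenter.
split=> [i||]; first exact: scale_syzygies_sub.
  (* The inclusion of S_M in S passes through the span of B_M. *)
  by apply/seteqP; split=> // x /SM_sub /B_sub.
by apply/seteqP; split=> // x /S_sub /SM_sub.
Qed.
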